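(* Let $Y\sim\mathrm{GMN}_d(\xi,\Sigma,\gamma,H)$ and let $d=d_1+d_2$ with $d_1,d_2\ge 1$. Partition $$Y=\begin{pmatrix}Y_1\\ Y_2\end{pmatrix},\quad \xi=\begin{pmatrix}\xi_1\\ \xi_2\end{pmatrix},\quad \gamma=\begin{pmatrix}\gamma_1\\ \gamma_2\end{pmatrix},\quad \Sigma=\begin{pmatrix}\Sigma_{11}&\Sigma_{12}\\ \Sigma_{21}&\Sigma_{22}\end{pmatrix}$$ into blocks of matching sizes $d_1,d_2$. Then $$Y_1\sim\mathrm{GMN}_{d_1}(\xi_1,\Sigma_{11},\gamma_1,H),\qquad Y_2\sim\mathrm{GMN}_{d_2}(\xi_2,\Sigma_{22},\gamma_2,H).$$
   Context: Generalized mixtures of normals (GMN). Let $\Sigma$ be a $d\times d$ symmetric positive definite matrix and $\xi,\gamma\in\mathbb{R}^d$. Let $X\sim\mathrm{N}_d(0,\Sigma)$ be a $d$-dimensional normal variable and $U,V$ univariate random variables such that $X,U,V$ are mutually independent. Let $r(u,v)$ be a real-valued function and $s(u,v)$ a positive-valued function, and let $R=r(U,V)$, $S=s(U,V)$ be the resulting random variables, so that $(R,S)$ is independent of $X$. Denote by $H$ the joint distribution (function) of $(R,S)$. If $Y=\xi+R\,\gamma+S\,X$, one writes $Y\sim\mathrm{GMN}_d(\xi,\Sigma,\gamma,H)$; this notation identifies the distribution of $Y$. *)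

(* Defs.v *)
From HB Require Import structures.
From mathcomp Require Import all_boot all_order all_algebra.
From mathcomp Require Import all_classical all_reals all_analysis.

Set Implicit Arguments.
Unset Strict Implicit.
Unset Printing Implicit Defensive.

Import Order.TTheory GRing.Theory Num.Theory.
Import numFieldNormedType.Exports.

Local Open Scope classical_set_scope.
Local Open Scope ring_scope.

Definition cV_display : measure_display -> measure_display.
Proof. exact. Qed.

(* Product sigma-algebra: for T = R this is the Borel sigma-algebra of R^n. *)
Section measurable_cV.
Context {d} {T : sigmaRingType d} (n : nat).

Let coord : 'I_n -> 'cV[T]_n -> T := fun i v => v i ord0.

Let cV_set0 : g_sigma_preimage coord set0.
Proof. exact: sigma_algebra0. Qed.

Let cV_setC A : g_sigma_preimage coord A -> g_sigma_preimage coord (~` A).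
Proof. exact: sigma_algebraC. Qed.

Let cV_bigcup (F : _^nat) : (forall i, g_sigma_preimage coord (F i)) ->
  g_sigma_preimage coord (\bigcup_i (F i)).
Proof. exact: sigma_algebra_bigcup. Qed.

HB.instance Definition _ := @isMeasurable.Build (cV_display d)
  'cV[T]_n (g_sigma_preimage coord) cV_set0 cV_setC cV_bigcup.

End measurable_cV.

Section measurable_cV_lemmas.
Context d1 d2 (T1 : measurableType d1) (T2 : measurableType d2).

Lemma measurable_coord n (i : 'I_n) :
  measurable_fun [set: 'cV[T2]_n] (fun v : 'cV[T2]_n => v i ord0).
Proof.
move=> _ Y mY; rewrite setTI; apply: sub_sigma_algebra => /=.
rewrite -bigcup_seq/=; exists i => /=; first by rewrite mem_index_enum.
by exists Y => //; rewrite setTI.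
Qed.

Lemma measurable_fun_cVP n (f : T1 -> 'cV[T2]_n) :
  measurable_fun [set: T1] f <->
  forall i, measurable_fun [set: T1] (fun t => f t i ord0).
Proof.
split=> [mf i|mf].
  exact: (measurableT_comp (measurable_coord i) mf).
have H : <<s \big[setU/set0]_(i < n) preimage_set_system [set: 'cV[T2]_n]
    (fun v : 'cV[T2]_n => v i ord0) measurable >> `<=`
    image_set_system [set: T1] f measurable.
  apply: smallest_sub.
    apply: sigma_algebra_image; exact: sigma_algebra_measurable.
  rewrite -bigcup_seq => A [i _ [B mB <-]].
  by have := mf i measurableT B mB; rewrite /image_set_system /= !setTI.
by move=> _ A /H.
Qed.

End measurable_cV_lemmas.

Section blocks.
Context {R : realType}.

(* measurableTypeR R is R with the measurable structure on which
   lebesgue_measure is declared. *)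
Definition cons_cV n (p : measurableTypeR R * 'cV[R]_n) : 'cV[R]_n.+1 :=
  col_mx (const_mx p.1 : 'cV[R]_1) p.2.

Definition uncons_cV n (v : 'cV[R]_n.+1) : measurableTypeR R * 'cV[R]_n :=
  (v ord0 ord0, dsubmx (v : 'cV[R]_(1 + n))).

Lemma cons_cVK n : cancel (@cons_cV n) (@uncons_cV n).
Proof.
case=> x v; rewrite /uncons_cV /cons_cV col_mxKd; congr pair.
transitivity (col_mx (const_mx x : 'cV[R]_1) v (lshift n ord0) ord0).
  by apply: (congr1 (fun i => col_mx _ _ i ord0)); exact/val_inj.
by rewrite col_mxEu mxE.
Qed.

Lemma uncons_cVK n : cancel (@uncons_cV n) (@cons_cV n).
Proof.
move=> v; rewrite /uncons_cV /cons_cV /= -[RHS](@vsubmxK _ 1 n 1).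
apply: (congr1 (fun u : 'cV[R]_1 => col_mx u _)); apply/matrixP => i j; rewrite !mxE !ord1.
by apply: (congr1 (fun k => v k ord0)); exact/val_inj.
Qed.

Lemma measurable_cons_cV n : measurable_fun [set: measurableTypeR R * 'cV[R]_n] (@cons_cV n).
Proof.
apply/measurable_fun_cVP => i; rewrite /cons_cV.
have [j ->|j ->] := @split_ordP 1 n i.
  rewrite (_ : (fun _ => _) = fst); first exact: measurable_fst.
  by apply/funext => p; rewrite [LHS](@col_mxEu R 1 n 1) mxE.
rewrite (_ : (fun _ => _) = (fun v : 'cV[R]_n => v j ord0) \o snd).
  exact: (measurableT_comp (measurable_coord j) measurable_snd).
by apply/funext => p; rewrite [LHS](@col_mxEd R 1 n 1).
Qed.

Lemma measurable_uncons_cV n : measurable_fun [set: 'cV[R]_n.+1] (@uncons_cV n).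
Proof.
apply: measurable_fun_pair; first exact: measurable_coord.
apply/measurable_fun_cVP => i; under eq_fun do rewrite mxE.
exact: measurable_coord.
Qed.

Lemma measurable_usubmx m n :
  measurable_fun [set: 'cV[R]_(m + n)] (@usubmx R m n 1).
Proof.
apply/measurable_fun_cVP => i; under eq_fun do rewrite mxE.
exact: measurable_coord.
Qed.

Lemma measurable_dsubmx m n :
  measurable_fun [set: 'cV[R]_(m + n)] (@dsubmx R m n 1).
Proof.
apply/measurable_fun_cVP => i; under eq_fun do rewrite mxE.
exact: measurable_coord.
Qed.

HB.instance Definition _ n := isMeasurableFun.Build _ _ _ _ (@cons_cV n) (@measurable_cons_cV n).
HB.instance Definition _ m n := isMeasurableFun.Build _ _ _ _ (@usubmx R m n 1) (@measurable_usubmx m n).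
HB.instance Definition _ m n := isMeasurableFun.Build _ _ _ _ (@dsubmx R m n 1) (@measurable_dsubmx m n).

End blocks.

Section lebesgue_cV.
Context {R : realType}.
Local Open Scope ereal_scope.

Section step.
Context n (m : {sigma_finite_measure set 'cV[R]_n -> \bar R}).

Definition lebesgue_cons : set 'cV[R]_n.+1 -> \bar R :=
  pushforward (lebesgue_measure \x m) (@cons_cV R n).

Let lebesgue_cons0 : lebesgue_cons set0 = 0.
Proof. by rewrite /lebesgue_cons /pushforward preimage_set0 measure0. Qed.

Let lebesgue_cons_ge0 A : 0 <= lebesgue_cons A.
Proof. by rewrite /lebesgue_cons /pushforward measure_ge0. Qed.

Let lebesgue_cons_sigma_additive : semi_sigma_additive lebesgue_cons.
Proof.
move=> F mF tF mUF; rewrite /lebesgue_cons /pushforward preimage_bigcup.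
have mpre A : measurable A -> measurable (@cons_cV R n @^-1` A).
  by move=> mA; rewrite -[X in measurable X]setTI; exact: measurable_cons_cV.
apply: measure_semi_sigma_additive => [i||].
- exact: mpre.
- apply/trivIsetP => i j _ _ ij; rewrite -preimage_setI.
  by move/trivIsetP : tF => /(_ _ _ _ _ ij) ->//; rewrite preimage_set0.
- by rewrite -preimage_bigcup; exact: mpre.
Qed.

HB.instance Definition _ := isMeasure.Build _ _ _ lebesgue_cons
  lebesgue_cons0 lebesgue_cons_ge0 lebesgue_cons_sigma_additive.

Let lebesgue_cons_sigma_finite : sigma_finite setT lebesgue_cons.
Proof.
have /sigma_finiteP[F [TF ndF Foo]] := sigma_finiteT (@lebesgue_measure R).
have /sigma_finiteP[G [TG ndG Goo]] := sigma_finiteT m.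
exists (fun k => @uncons_cV R n @^-1` (F k `*` G k)).
  apply/esym; rewrite -subTset => v _.
  have [i _ Fi] : (\bigcup_i F i)%classic (uncons_cV v).1 by rewrite -TF.
  have [j _ Gj] : (\bigcup_i G i)%classic (uncons_cV v).2 by rewrite -TG.
  exists (maxn i j) => //; split => /=.
    by move: Fi; exact/subsetPset/ndF/leq_maxl.
  by move: Gj; exact/subsetPset/ndG/leq_maxr.
move=> k; have [mF Fk] := Foo k; have [mG Gk] := Goo k; split.
  rewrite -[X in measurable X]setTI.
  by apply: measurable_uncons_cV => //; exact: measurableX.
rewrite /lebesgue_cons /pushforward -comp_preimage.
rewrite (_ : _ \o _ = id) ?preimage_id; last exact/funext/cons_cVK.
by rewrite product_measure1E// lte_mul_pinfty// ge0_fin_numE.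
Qed.

HB.instance Definition _ := Measure_isSigmaFinite.Build _ _ _ lebesgue_cons
  lebesgue_cons_sigma_finite.

End step.

(* Lebesgue measure on R^n, as the iterated product of the Lebesgue measure on
   R; on R^0 it is the unit mass at the only point. *)
Fixpoint lebesgue_cV n : {sigma_finite_measure set 'cV[R]_n -> \bar R} :=
  if n is n'.+1 then lebesgue_cons (lebesgue_cV n') else \d_(0%R : 'cV[R]_0).

End lebesgue_cV.

Section GMN.
Context {R : realType}.

Definition posdefmx n (S : 'M[R]_n) : Prop :=
  S^T = S /\ forall x : 'cV[R]_n, x != 0 -> 0 < (x^T *m S *m x) ord0 ord0.

(* Density of N_n(m, S): exp(- (x - m)^T S^-1 (x - m) / 2) /
   sqrt((2 pi)^n det S), for S positive definite. *)
Definition mvn_pdf n (m : 'cV[R]_n) (S : 'M[R]_n) (x : 'cV[R]_n) : R :=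
  expR (- ((x - m)^T *m invmx S *m (x - m)) ord0 ord0 / 2)
  / Num.sqrt ((2 * pi) ^+ n * \det S).

(* X ~ N_n(m, S) *)
Definition is_mvn d (T : measurableType d) (P : probability T R) n
    (X : {RV P >-> 'cV[R]_n}) (m : 'cV[R]_n) (S : 'M[R]_n) : Prop :=
  posdefmx S /\
  forall A : set 'cV[R]_n, measurable A ->
    distribution P X A = (\int[lebesgue_cV n]_(x in A) (mvn_pdf m S x)%:E)%E.

(* Taking some of A, B, C to be full gives the product rule for the
   subfamilies. *)
Definition mutually_independent3 d (T : measurableType d) (P : probability T R)
    d1 d2 d3 (E1 : measurableType d1) (E2 : measurableType d2)
    (E3 : measurableType d3)
    (X : {RV P >-> E1}) (U : {RV P >-> E2}) (V : {RV P >-> E3}) : Prop :=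
  forall (A : set E1) (B : set E2) (C : set E3),
    measurable A -> measurable B -> measurable C ->
    P (X @^-1` A `&` U @^-1` B `&` V @^-1` C) =
      (P (X @^-1` A) * P (U @^-1` B) * P (V @^-1` C))%E.

(* Y ~ GMN_n(xi, S, g, H).  The notation identifies a distribution: X, U, V
   may live on a probability space other than that of Y, and only the law of
   xi + R g + S X is compared with that of Y.  H is the joint law of (R, S). *)
Definition is_GMN d (T : measurableType d) (P : probability T R) n
    (Y : {RV P >-> 'cV[R]_n}) (xi : 'cV[R]_n) (Sigma : 'M[R]_n)
    (gamma : 'cV[R]_n) (H : probability (R * R)%type R) : Prop :=
  exists (d' : measure_display) (T' : measurableType d')
    (P' : probability T' R) (X : {RV P' >-> 'cV[R]_n}) (U V : {RV P' >-> R})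
    (r s : {mfun (R * R)%type >-> R}),
  let Rv := fun t => r (U t, V t) in
  let Sv := fun t => s (U t, V t) in
  [/\ is_mvn X 0 Sigma,
      mutually_independent3 X U V,
      forall u v, 0 < s (u, v),
      forall B : set (R * R), measurable B ->
        H B = P' ((fun t => (Rv t, Sv t)) @^-1` B)
    & forall A : set 'cV[R]_n, measurable A ->
        distribution P Y A =
        P' ((fun t => xi + Rv t *: gamma + Sv t *: X t) @^-1` A)].

End GMN.

(* Main.v *)
Require Import Defs.
From mathcomp Require Import all_boot all_order all_algebra.
From mathcomp Require Import all_classical all_reals all_analysis.
From mathcomp Require Import measurable_realfun ring.

(** In law, Y is xi + R gamma + S X.  Projecting on the i-th block of
coordinates is linear, so the projection of Y has the law of
xi_i + R gamma_i + S X_i with the same (U, V), hence the same H; and X_i, being a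
function of X, is still independent of (U, V).  This is [is_GMN_linear].  The
content of the theorem is therefore that a block X_i of a normal vector X is
normal with the corresponding block of Sigma as covariance, which has to be read
off from densities since normality is defined by a density.

Let z = (x, y) be the block decomposition of a point.  The block LDL^T
factorization of Sigma, with the Schur complement C of a diagonal block, turns
the density of X into (marginal density of one block) times (normal density in
the other block, with covariance C and with a mean that depends on the first
block): [mvn_pdf_cond_ul] and [mvn_pdf_cond_dr].  Lebesgue measure on R^(m+n),
although built one coordinate at a time, is integrated by integrating over the
two blocks in either order: [integral_lebesgue_cVD] and
[integral_lebesgue_cVD_swap].  Integrating out the conditioned block leaves the
marginal density of the other, because every multivariate normal density has
integral 1: [integral_mvn_pdf], by induction on the dimension from the same
factorization with a first block of size 1, where the one-dimensional Gaussian
integral applies. *)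

Set Implicit Arguments.
Unset Strict Implicit.
Unset Printing Implicit Defensive.

Import Order.TTheory GRing.Theory Num.Theory.
Import numFieldNormedType.Exports.

Local Open Scope classical_set_scope.
Local Open Scope ring_scope.

(** * Positive definite block matrices and the factorization of the normal density *)

Section posdef.
Context {R : realType}.

(** The hypothesis is the injectivity of A^T, so that the quadratic form of S is
evaluated at a nonzero vector.  With A a coordinate projection this covers
diagonal blocks, and with A invertible the change of basis of the block
factorization. *)
Lemma posdefmx_congr m n (A : 'M[R]_(m, n)) (S : 'M[R]_n) :
  (forall x : 'cV[R]_m, A^T *m x = 0 -> x = 0) ->
  posdefmx S -> posdefmx (A *m S *m A^T).
Proof.
move=> injA [symS posS]; split; first by rewrite !trmx_mul trmxK symS mulmxA.
move=> x x0; have := posS (A^T *m x).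
rewrite trmx_mul trmxK !mulmxA; apply.
by apply: contra_neq x0; exact: injA.
Qed.

Lemma posdefmx_ulsubmx m n (S : 'M[R]_(m + n)) :
  posdefmx S -> posdefmx (ulsubmx S).
Proof.
have -> : ulsubmx S = row_mx 1%:M 0 *m S *m (row_mx 1%:M 0)^T.
  rewrite -{2}(submxK S) tr_row_mx trmx1 trmx0 mul_row_block mul_row_col.
  by rewrite !mul1mx !mul0mx !addr0 mulmx1 mulmx0 addr0.
apply: posdefmx_congr => x.
rewrite tr_row_mx trmx1 trmx0 mul_col_mx mul1mx mul0mx -[RHS]col_mx0.
by move/eq_col_mx => [].
Qed.

Lemma posdefmx_drsubmx m n (S : 'M[R]_(m + n)) :
  posdefmx S -> posdefmx (drsubmx S).
Proof.
have -> : drsubmx S = row_mx 0 1%:M *m S *m (row_mx 0 1%:M)^T.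
  rewrite -{2}(submxK S) tr_row_mx trmx1 trmx0 mul_row_block mul_row_col.
  by rewrite !mul1mx !mul0mx !add0r mulmx1 mulmx0 add0r.
apply: posdefmx_congr => x.
rewrite tr_row_mx trmx1 trmx0 mul_col_mx mul1mx mul0mx -[RHS]col_mx0.
by move/eq_col_mx => [].
Qed.

Lemma posdefmx_unit n (S : 'M[R]_n) : posdefmx S -> S \in unitmx.
Proof.
move=> [symS posS]; rewrite -row_free_unit -kermx_eq0; apply/rowV0P => v.
move=> /sub_kermxP vS0; apply/eqP/negPn/negP => v0.
have := posS v^T; rewrite trmxK vS0 mul0mx mxE ltxx trmx_eq0 => /(_ v0).
by [].
Qed.

(** Schur complement of the upper left block: the conditional covariance of the
lower block given the upper one. *)
Definition schur_ul m n (S : 'M[R]_(m + n)) : 'M[R]_n :=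
  drsubmx S - dlsubmx S *m invmx (ulsubmx S) *m ursubmx S.

(** Schur complement of the lower right block: the conditional covariance of the
upper block given the lower one. *)
Definition schur_dr m n (S : 'M[R]_(m + n)) : 'M[R]_m :=
  ulsubmx S - ursubmx S *m invmx (drsubmx S) *m dlsubmx S.

Lemma posdefmx_block_tr m n (S : 'M[R]_(m + n)) : posdefmx S ->
  [/\ (ulsubmx S)^T = ulsubmx S, (ursubmx S)^T = dlsubmx S,
      (dlsubmx S)^T = ursubmx S & (drsubmx S)^T = drsubmx S].
Proof.
by move=> [symS _]; rewrite trmx_ulsub trmx_ursub trmx_dlsub trmx_drsub symS.
Qed.

(** Block Gaussian elimination of the lower left block; by symmetry the same
factor L also clears the upper right block. *)
Lemma schur_ulE m n (S : 'M[R]_(m + n))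
    (L := block_mx 1%:M 0 (dlsubmx S *m invmx (ulsubmx S)) 1%:M) :
  posdefmx S ->
  S = L *m block_mx (ulsubmx S) 0 0 (schur_ul S) *m L^T.
Proof.
move=> pS; have [tul tur tdl tdr] := posdefmx_block_tr pS.
have uS := posdefmx_unit (posdefmx_ulsubmx pS).
rewrite /L tr_block_mx !trmx1 trmx0 trmx_mul trmx_inv tul tdl.
rewrite !mulmx_block !(mul1mx, mulmx1, mul0mx, mulmx0, addr0, add0r).
by rewrite mulmxKV// mulKVmx// !mulmxA subrKC submxK.
Qed.

Lemma schur_drE m n (S : 'M[R]_(m + n))
    (L := block_mx 1%:M (ursubmx S *m invmx (drsubmx S)) 0 1%:M) :
  posdefmx S ->
  S = L *m block_mx (schur_dr S) 0 0 (drsubmx S) *m L^T.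
Proof.
move=> pS; have [tul tur tdl tdr] := posdefmx_block_tr pS.
have uS := posdefmx_unit (posdefmx_drsubmx pS).
rewrite /L tr_block_mx !trmx1 trmx0 trmx_mul trmx_inv tdr tur.
rewrite !mulmx_block !(mul1mx, mulmx1, mul0mx, mulmx0, addr0, add0r).
by rewrite mulmxKV// mulKVmx// !mulmxA subrK submxK.
Qed.

Lemma posdefmx_congrV n (L D : 'M[R]_n) : \det L = 1 ->
  posdefmx (L *m D *m L^T) -> posdefmx D.
Proof.
move=> dL pS; have uL : L \in unitmx by rewrite unitmxE dL unitr1.
have -> : D = invmx L *m (L *m D *m L^T) *m (invmx L)^T.
  by rewrite trmx_inv !mulmxA mulVmx// mul1mx mulmxK// unitmx_tr.
apply: posdefmx_congr pS => x; rewrite trmx_inv => /(congr1 (mulmx L^T)).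
by rewrite mulKVmx ?unitmx_tr// mulmx0.
Qed.

Lemma posdefmx_schur_ul m n (S : 'M[R]_(m + n)) :
  posdefmx S -> posdefmx (schur_ul S).
Proof.
move=> pS; move: (pS); rewrite {1}(schur_ulE pS) => /posdefmx_congrV.
rewrite det_lblock !det1 mulr1 => /(_ erefl)/posdefmx_drsubmx.
by rewrite block_mxKdr.
Qed.

Lemma posdefmx_schur_dr m n (S : 'M[R]_(m + n)) :
  posdefmx S -> posdefmx (schur_dr S).
Proof.
move=> pS; move: (pS); rewrite {1}(schur_drE pS) => /posdefmx_congrV.
rewrite det_ublock !det1 mulr1 => /(_ erefl)/posdefmx_ulsubmx.
by rewrite block_mxKul.
Qed.

Lemma det_schur_ul m n (S : 'M[R]_(m + n)) :
  posdefmx S -> \det S = \det (ulsubmx S) * \det (schur_ul S).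
Proof.
move=> pS; rewrite {1}(schur_ulE pS) !det_mulmx det_tr.
by rewrite !det_lblock !det1 !mul1r mulr1.
Qed.

(** Induction on the dimension: the factorization with a first block of size 1
reduces to a positive entry and to the Schur complement, which is positive
definite of smaller size. *)
Lemma posdefmx_det_gt0 n (S : 'M[R]_n) : posdefmx S -> 0 < \det S.
Proof.
elim: n S => [|n IHn] S pS; first by rewrite det_mx00 ltr01.
rewrite (@det_schur_ul 1 n S pS).
rewrite mulr_gt0 ?(IHn _ (@posdefmx_schur_ul 1 n S pS))//.
have [_ /(_ 1)] := @posdefmx_ulsubmx 1 n S pS.
by rewrite trmx1 mul1mx mulmx1 det_mx11; apply; exact: oner_neq0.
Qed.

(** Change of variables under a linear map of determinant 1: the quadratic form
is transported by L, and the normalizing constant does not change. *)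
Lemma mvn_pdf_congr n (L D : 'M[R]_n) (m x : 'cV[R]_n) :
  \det L = 1 -> D \in unitmx ->
  mvn_pdf m (L *m D *m L^T) x = mvn_pdf 0 D (invmx L *m (x - m)).
Proof.
move=> dL uD; have uL : L \in unitmx by rewrite unitmxE dL unitr1.
have uLT : L^T \in unitmx by rewrite unitmx_tr.
have invE : invmx (L *m D *m L^T) = (invmx L)^T *m invmx D *m invmx L.
  apply: (can_inj (mulKmx (_ : L *m D *m L^T \in unitmx))).
    by rewrite !unitmx_mul uL uD.
  rewrite mulmxV ?unitmx_mul ?uL ?uD// trmx_inv -!mulmxA.
  by rewrite mulKVmx// mulKVmx// mulmxV.
rewrite /mvn_pdf !det_mulmx det_tr dL mul1r mulr1 invE.
by rewrite subr0 trmx_mul !mulmxA.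
Qed.

Lemma mvn_pdf_block_diag m n (A : 'M[R]_m) (B : 'M[R]_n)
    (x : 'cV[R]_m) (y : 'cV[R]_n) :
  posdefmx A -> posdefmx B ->
  mvn_pdf 0 (block_mx A 0 0 B) (col_mx x y) = mvn_pdf 0 A x * mvn_pdf 0 B y.
Proof.
move=> pA pB; rewrite /mvn_pdf !subr0.
have uA := posdefmx_unit pA; have uB := posdefmx_unit pB.
rewrite invmx_block_diag; last first.
  by rewrite unitmxE det_ublock unitrM -!unitmxE uA.
rewrite det_ublock tr_col_mx mul_row_block mul_row_col.
rewrite !mulmx0 addr0 add0r mxE mulrACA -invfM -expRD.
rewrite exprD mulrACA sqrtrM ?mulr_ge0 ?exprn_ge0 ?mulr_ge0 ?pi_ge0//.
  by rewrite opprD mulrDl.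
exact/ltW/posdefmx_det_gt0.
Qed.

Lemma mvn_pdf_shift n (m a : 'cV[R]_n) S x :
  mvn_pdf m S (x - a) = mvn_pdf (m + a) S x.
Proof. by rewrite /mvn_pdf opprD addrAC addrA addrAC. Qed.

Definition cond_mean_ul m n (mu : 'cV[R]_(m + n)) (S : 'M[R]_(m + n))
    (x : 'cV[R]_m) : 'cV[R]_n :=
  dsubmx mu + dlsubmx S *m invmx (ulsubmx S) *m (x - usubmx mu).

Definition cond_mean_dr m n (mu : 'cV[R]_(m + n)) (S : 'M[R]_(m + n))
    (y : 'cV[R]_n) : 'cV[R]_m :=
  usubmx mu + ursubmx S *m invmx (drsubmx S) *m (y - dsubmx mu).

(** The inverse of the factor L of [schur_ulE] subtracts from y its regression on
x.  In the new coordinates the covariance is block diagonal and the density is a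
product; undoing the translation in the second factor gives a conditional mean
depending on x. *)
Lemma mvn_pdf_cond_ul m n (S : 'M[R]_(m + n)) (mu : 'cV[R]_(m + n)) x y :
  posdefmx S ->
  mvn_pdf mu S (col_mx x y) =
    mvn_pdf (usubmx mu) (ulsubmx S) x *
    mvn_pdf (cond_mean_ul mu S x) (schur_ul S) y.
Proof.
move=> pS; rewrite /cond_mean_ul; set K := _ *m invmx _.
have dL : \det (block_mx 1%:M 0 K 1%:M) = 1 by rewrite det_lblock !det1 mulr1.
have pA := posdefmx_ulsubmx pS; have pC := posdefmx_schur_ul pS.
rewrite {1}(schur_ulE pS) mvn_pdf_congr//; last first.
  by rewrite unitmxE det_ublock unitrM -!unitmxE !posdefmx_unit.
have -> : invmx (block_mx 1%:M 0 K 1%:M) *m (col_mx x y - mu) =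
    col_mx (x - usubmx mu) (y - (dsubmx mu + K *m (x - usubmx mu))).
  apply: (can_inj (mulKmx (_ : block_mx 1%:M 0 K 1%:M \in unitmx))).
    by rewrite unitmxE dL unitr1.
  rewrite mulKVmx ?unitmxE ?dL ?unitr1// mul_block_col.
  rewrite !mul1mx mul0mx addr0 opprD addrCA [X in y + X]addrCA subrr addr0.
  by rewrite -{1}(vsubmxK mu) opp_col_mx add_col_mx.
by rewrite mvn_pdf_block_diag// !mvn_pdf_shift !add0r.
Qed.

Lemma mvn_pdf_cond_dr m n (S : 'M[R]_(m + n)) (mu : 'cV[R]_(m + n)) x y :
  posdefmx S ->
  mvn_pdf mu S (col_mx x y) =
    mvn_pdf (dsubmx mu) (drsubmx S) y *
    mvn_pdf (cond_mean_dr mu S y) (schur_dr S) x.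
Proof.
move=> pS; rewrite /cond_mean_dr; set K := _ *m invmx _.
have dL : \det (block_mx 1%:M K 0 1%:M) = 1 by rewrite det_ublock !det1 mulr1.
have pA := posdefmx_drsubmx pS; have pC := posdefmx_schur_dr pS.
rewrite {1}(schur_drE pS) mvn_pdf_congr//; last first.
  by rewrite unitmxE det_ublock unitrM -!unitmxE !posdefmx_unit.
have -> : invmx (block_mx 1%:M K 0 1%:M) *m (col_mx x y - mu) =
    col_mx (x - (usubmx mu + K *m (y - dsubmx mu))) (y - dsubmx mu).
  apply: (can_inj (mulKmx (_ : block_mx 1%:M K 0 1%:M \in unitmx))).
    by rewrite unitmxE dL unitr1.
  rewrite mulKVmx ?unitmxE ?dL ?unitr1// mul_block_col.
  rewrite !mul1mx mul0mx add0r opprD addrA subrK.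
  by rewrite -{1}(vsubmxK mu) opp_col_mx add_col_mx.
by rewrite mvn_pdf_block_diag// !mvn_pdf_shift !add0r mulrC.
Qed.

End posdef.

(** * Lebesgue measure on a product of two blocks *)

Section lebesgue_blocks.
Context {R : realType}.
Local Open Scope ereal_scope.

Lemma measurable_col_mx m n : measurable_fun [set: 'cV[R]_m * 'cV[R]_n]
  (fun p => col_mx p.1 p.2 : 'cV[R]_(m + n)).
Proof.
apply/measurable_fun_cVP => i; have [j ->|j ->] := split_ordP i.
  under eq_fun do rewrite col_mxEu.
  exact: (measurableT_comp (measurable_coord j) measurable_fst).
under eq_fun do rewrite col_mxEd.
exact: (measurableT_comp (measurable_coord j) measurable_snd).
Qed.

Lemma integral_lebesgue_cVS n (f : 'cV[R]_n.+1 -> \bar R) :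
  measurable_fun [set: 'cV[R]_n.+1] f -> (forall x, 0 <= f x) ->
  \int[lebesgue_cV n.+1]_z f z =
  \int[@lebesgue_measure R]_t \int[lebesgue_cV n]_x f (cons_cV (t, x)).
Proof.
move=> mf f0; transitivity
    (\int[lebesgue_measure \x lebesgue_cV n]_p (f \o @cons_cV R n) p).
  by rewrite [LHS](ge0_integral_pushforward (@measurable_cons_cV R n)).
rewrite fubini_tonelli1//.
  exact: measurableT_comp.
by move=> p; exact: f0.
Qed.

(** Associativity of block concatenation; the dimensions 1 + (m + n) and
(1 + m) + n are convertible, so the cast in the general law is the identity. *)
Lemma cons_col_mx m n t (x : 'cV[R]_m) (y : 'cV[R]_n) :
  cons_cV (t, col_mx x y) =
  col_mx (cons_cV (t, x) : 'cV[R]_m.+1) y :> 'cV[R]_(m.+1 + n).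
Proof.
exact: (etrans (@col_mxA R 1 m n 1 _ _ _) (@castmx_id R (1 + m + n) 1 _ _)).
Qed.

Lemma measurable_fun_col_mx m n (f : 'cV[R]_(m + n) -> \bar R) :
  measurable_fun [set: 'cV[R]_(m + n)] f ->
  measurable_fun [set: 'cV[R]_m * 'cV[R]_n] (fun p => f (col_mx p.1 p.2)).
Proof. by move=> mf; apply: measurableT_comp mf _; exact: measurable_col_mx. Qed.

Lemma measurable_integral_col_mx m n (f : 'cV[R]_(m + n) -> \bar R) :
  measurable_fun [set: 'cV[R]_(m + n)] f -> (forall x, 0 <= f x) ->
  measurable_fun [set: 'cV[R]_m]
    (fun x : 'cV[R]_m => \int[lebesgue_cV n]_y f (col_mx x y)).
Proof.
move=> /measurable_fun_col_mx mf f0.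
apply: (@measurable_fun_fubini_tonelli_F _ _ _ _ R (lebesgue_cV n)
  (fun p : 'cV[R]_m * 'cV[R]_n => f (col_mx p.1 p.2)) mf) => p.
exact: f0.
Qed.

(** Induction on m, splitting off the first coordinate on both sides.  For m = 0
the outer measure is the unit mass at the only point of R^0. *)
Lemma integral_lebesgue_cVD m n (f : 'cV[R]_(m + n) -> \bar R) :
  measurable_fun [set: 'cV[R]_(m + n)] f -> (forall x, 0 <= f x) ->
  \int[lebesgue_cV (m + n)]_z f z =
  \int[lebesgue_cV m]_x \int[lebesgue_cV n]_y f (col_mx x y).
Proof.
elim: m f => [|m IHm] f mf f0.
  rewrite [RHS]integral_dirac//; last exact: measurable_integral_col_mx.
  rewrite diracT mul1e; apply: eq_integral => y _.
  by rewrite col_flat_mx.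
rewrite [LHS]integral_lebesgue_cVS// integral_lebesgue_cVS; last 2 first.
- exact: measurable_integral_col_mx.
- by move=> x; exact: integral_ge0.
apply: eq_integral => t _.
rewrite (IHm (fun z : 'cV[R]_(m + n) => f (cons_cV (t, z)))) => [|//|z].
- apply: eq_integral => x _; apply: eq_integral => y _.
  by rewrite cons_col_mx.
- apply: (measurableT_comp mf).
  apply: (measurableT_comp (@measurable_cons_cV R _)).
  by apply: measurable_fun_pair; [exact: measurable_cst|exact: measurable_id].
- exact: f0.
Qed.

Lemma integral_lebesgue_cVD_swap m n (f : 'cV[R]_(m + n) -> \bar R) :
  measurable_fun [set: 'cV[R]_(m + n)] f -> (forall x, 0 <= f x) ->
  \int[lebesgue_cV (m + n)]_z f z =
  \int[lebesgue_cV n]_y \int[lebesgue_cV m]_x f (col_mx x y).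
Proof.
move=> mf f0; rewrite integral_lebesgue_cVD//.
apply: (@fubini_tonelli _ _ _ _ R (lebesgue_cV m) (lebesgue_cV n)
  (fun p : 'cV[R]_m * 'cV[R]_n => f (col_mx p.1 p.2))) => [|p].
  exact: measurable_fun_col_mx.
exact: f0.
Qed.

End lebesgue_blocks.

(** * Gaussian integrals *)

Section gaussian_integrals.
Context {R : realType}.

Lemma mvn_pdf_ge0 n (m : 'cV[R]_n) S x : 0 <= mvn_pdf m S x.
Proof. by rewrite /mvn_pdf divr_ge0 ?expR_ge0 ?sqrtr_ge0. Qed.

Lemma measurable_mvn_pdf n (m : 'cV[R]_n) S :
  measurable_fun [set: 'cV[R]_n] (mvn_pdf m S).
Proof.
apply: measurable_funM => //; apply: measurableT_comp => //.
apply: measurable_funM => //; apply: measurableT_comp => //.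
under eq_fun do rewrite mxE; apply: measurable_sum => i.
apply: measurable_funM; last first.
  under eq_fun do rewrite !mxE.
  by apply: measurable_funB => //; exact: measurable_coord.
under eq_fun do rewrite mxE; apply: measurable_sum => j.
apply: measurable_funM => //.
under eq_fun do rewrite !mxE.
by apply: measurable_funB => //; exact: measurable_coord.
Qed.

Lemma mvn_pdf1E (m : 'cV[R]_1) (S : 'M[R]_1) (x : 'cV[R]_1) : posdefmx S ->
  mvn_pdf m S x = normal_pdf (m 0 0) (Num.sqrt (S 0 0)) (x 0 0).
Proof.
move=> pS; have s0 : 0 < S 0 0 by have := posdefmx_det_gt0 pS; rewrite det_mx11.
rewrite normal_pdfE ?gt_eqF ?sqrtr_gt0// /normal_peak /normal_fun.
rewrite /mvn_pdf det_mx11 sqr_sqrtr ?ltW// mulrC expr1; congr (_^-1 * expR _).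
  by congr Num.sqrt; rewrite -mulr_natl mulrAC; ring.
rewrite [invmx S](_ : _ = ((S 0 0)^-1)%:M); last first.
  by rewrite {1}[S]mx11_scalar invmx_scalar.
rewrite mul_mx_scalar -scalemxAl !mxE big_ord1 !mxE.
by field; rewrite gt_eqF.
Qed.

Local Open Scope ereal_scope.

Lemma integral_mvn_pdf1 (m : 'cV[R]_1) (S : 'M[R]_1) : posdefmx S ->
  \int[lebesgue_cV 1]_x (mvn_pdf m S x)%:E = 1.
Proof.
move=> pS; rewrite integral_lebesgue_cVS; last 2 first.
- by apply/measurable_EFinP; exact: measurable_mvn_pdf.
- by move=> x; rewrite lee_fin mvn_pdf_ge0.
rewrite -(integral_normal_pdf (m 0%R 0%R) (Num.sqrt (S 0%R 0%R))).
apply: eq_integral => t _; rewrite integral_dirac//; last first.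
  apply/measurable_EFinP; apply: (measurableT_comp (measurable_mvn_pdf m S)).
  apply: (measurableT_comp (@measurable_cons_cV R 0)).
  by apply: measurable_fun_pair; [exact: measurable_cst|exact: measurable_id].
rewrite diracT mul1e mvn_pdf1E//.
by have := congr1 fst (cons_cVK (t, 0%R : 'cV[R]_0)) => /= ->.
Qed.

(** The family g is a conditional density of the second variable given the first,
so integrating it out leaves f.  The condition on the first variable is kept
inside the double integral because it comes from a set of pairs. *)
Lemma integral_marginal d1 d2 (T1 : measurableType d1) (T2 : measurableType d2)
    (m1 : {measure set T1 -> \bar R}) (m2 : {measure set T2 -> \bar R})
    (A : set T1) (f : T1 -> R) (g : T1 -> T2 -> R) :
  (forall x, 0 <= f x)%R -> (forall x y, 0 <= g x y)%R ->
  (forall x, measurable_fun [set: T2] (g x)) ->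
  (forall x, \int[m2]_y (g x y)%:E = 1) ->
  \int[m1]_x \int[m2]_y (if x \in A then (f x * g x y)%:E else 0) =
  \int[m1]_(x in A) (f x)%:E.
Proof.
move=> f0 g0 mg g1; rewrite [RHS]integral_mkcond; apply: eq_integral => x _.
rewrite patchE; case: ifPn => _; last exact: integral0.
under eq_integral do rewrite EFinM.
rewrite ge0_integralZl//; first by rewrite g1 mule1.
- exact/measurable_EFinP.
- by move=> y _; rewrite lee_fin.
- by rewrite lee_fin.
Qed.

(** The factorization conditioned on the first coordinate reduces dimension n + 1
to dimensions 1 and n.  The mean is universally quantified in the induction
because the conditional mean varies with the first coordinate. *)
Lemma integral_mvn_pdf n (m : 'cV[R]_n) (S : 'M[R]_n) : posdefmx S ->
  \int[lebesgue_cV n]_x (mvn_pdf m S x)%:E = 1.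
Proof.
elim: n m S => [|n IHn] m S pS.
  rewrite integral_dirac//; last first.
    by apply/measurable_EFinP; exact: measurable_mvn_pdf.
  rewrite diracT mul1e /mvn_pdf [in X in expR X]mxE big_ord0 oppr0 mul0r expR0.
  by rewrite expr0 det_mx00 mulr1 sqrtr1 divr1.
rewrite (@integral_lebesgue_cVD R 1 n); last 2 first.
- by apply/measurable_EFinP; exact: measurable_mvn_pdf.
- by move=> x; rewrite lee_fin mvn_pdf_ge0.
rewrite -(integral_mvn_pdf1 (usubmx (m : 'cV[R]_(1 + n)))
  (@posdefmx_ulsubmx R 1 n S pS)).
rewrite -(@integral_marginal _ _ _ _ (lebesgue_cV 1) (lebesgue_cV n) setT _
  (fun x => mvn_pdf (cond_mean_ul (m : 'cV[R]_(1 + n)) S x)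
                    (schur_ul (S : 'M[R]_(1 + n))))).
- apply: eq_integral => x _; apply: eq_integral => y _.
  by rewrite in_setT (@mvn_pdf_cond_ul R 1 n).
- by move=> x; exact: mvn_pdf_ge0.
- by move=> x y; exact: mvn_pdf_ge0.
- by move=> x; exact: measurable_mvn_pdf.
- by move=> x; apply: IHn; exact: (@posdefmx_schur_ul R 1 n).
Qed.

Lemma measurable_mvn_pdf_restrict n (mu : 'cV[R]_n) S (B : set 'cV[R]_n) :
  measurable B ->
  measurable_fun [set: 'cV[R]_n] ((fun z => (mvn_pdf mu S z)%:E) \_ B).
Proof.
move=> mB; apply/(measurable_restrictT _ _).1 => //.
by apply: measurable_funTS; apply/measurable_EFinP; exact: measurable_mvn_pdf.
Qed.

Lemma mvn_pdf_restrict_ge0 n (mu : 'cV[R]_n) S (B : set 'cV[R]_n) z :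
  0 <= ((fun z => (mvn_pdf mu S z)%:E) \_ B) z.
Proof. by rewrite patchE; case: ifP => // _; rewrite lee_fin mvn_pdf_ge0. Qed.

Lemma integral_mvn_pdf_usubmx m n (mu : 'cV[R]_(m + n)) (S : 'M[R]_(m + n)) A :
  posdefmx S -> measurable A ->
  \int[lebesgue_cV (m + n)]_(z in usubmx @^-1` A) (mvn_pdf mu S z)%:E =
  \int[lebesgue_cV m]_(x in A) (mvn_pdf (usubmx mu) (ulsubmx S) x)%:E.
Proof.
move=> pS mA; have mB : measurable (@usubmx R m n 1 @^-1` A).
  by rewrite -[X in measurable X]setTI; exact: measurable_usubmx.
rewrite integral_mkcond integral_lebesgue_cVD; last 2 first.
- exact: measurable_mvn_pdf_restrict.
- by move=> z; exact: mvn_pdf_restrict_ge0.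
rewrite -(@integral_marginal _ _ _ _ (lebesgue_cV m) (lebesgue_cV n) A _
  (fun x => mvn_pdf (cond_mean_ul mu S x) (schur_ul S))).
- apply: eq_integral => x _; apply: eq_integral => y _.
  have -> : (x \in A) = (col_mx x y \in usubmx @^-1` A).
    by apply/idP/idP; rewrite !inE /= col_mxKu.
  by rewrite patchE mvn_pdf_cond_ul.
- by move=> x; exact: mvn_pdf_ge0.
- by move=> x y; exact: mvn_pdf_ge0.
- by move=> x; exact: measurable_mvn_pdf.
- by move=> x; apply: integral_mvn_pdf; exact: posdefmx_schur_ul.
Qed.

Lemma integral_mvn_pdf_dsubmx m n (mu : 'cV[R]_(m + n)) (S : 'M[R]_(m + n)) A :
  posdefmx S -> measurable A ->
  \int[lebesgue_cV (m + n)]_(z in dsubmx @^-1` A) (mvn_pdf mu S z)%:E =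
  \int[lebesgue_cV n]_(y in A) (mvn_pdf (dsubmx mu) (drsubmx S) y)%:E.
Proof.
move=> pS mA; have mB : measurable (@dsubmx R m n 1 @^-1` A).
  by rewrite -[X in measurable X]setTI; exact: measurable_dsubmx.
rewrite integral_mkcond integral_lebesgue_cVD_swap; last 2 first.
- exact: measurable_mvn_pdf_restrict.
- by move=> z; exact: mvn_pdf_restrict_ge0.
rewrite -(@integral_marginal _ _ _ _ (lebesgue_cV n) (lebesgue_cV m) A _
  (fun y => mvn_pdf (cond_mean_dr mu S y) (schur_dr S))).
- apply: eq_integral => y _; apply: eq_integral => x _.
  have -> : (y \in A) = (col_mx x y \in dsubmx @^-1` A).
    by apply/idP/idP; rewrite !inE /= col_mxKd.
  by rewrite patchE mvn_pdf_cond_dr.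
- by move=> y; exact: mvn_pdf_ge0.
- by move=> y x; exact: mvn_pdf_ge0.
- by move=> y; exact: measurable_mvn_pdf.
- by move=> y; apply: integral_mvn_pdf; exact: posdefmx_schur_dr.
Qed.

End gaussian_integrals.

(** * Blocks of normal vectors and of their generalized mixtures *)

Section GMN_blocks.
Context {R : realType}.

Lemma is_mvn_usubmx d (T : measurableType d) (P : probability T R) m n
    (X : {RV P >-> 'cV[R]_(m + n)}) (mu : 'cV[R]_(m + n)) (S : 'M[R]_(m + n)) :
  is_mvn X mu S ->
  is_mvn (usubmx \o X : {RV P >-> 'cV[R]_m}) (usubmx mu) (ulsubmx S).
Proof.
move=> [pS XE]; split; first exact: posdefmx_ulsubmx.
move=> A mA; rewrite -integral_mvn_pdf_usubmx// -XE//.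
by rewrite -[X in measurable X]setTI; exact: measurable_usubmx.
Qed.

Lemma is_mvn_dsubmx d (T : measurableType d) (P : probability T R) m n
    (X : {RV P >-> 'cV[R]_(m + n)}) (mu : 'cV[R]_(m + n)) (S : 'M[R]_(m + n)) :
  is_mvn X mu S ->
  is_mvn (dsubmx \o X : {RV P >-> 'cV[R]_n}) (dsubmx mu) (drsubmx S).
Proof.
move=> [pS XE]; split; first exact: posdefmx_drsubmx.
move=> A mA; rewrite -integral_mvn_pdf_dsubmx// -XE//.
by rewrite -[X in measurable X]setTI; exact: measurable_dsubmx.
Qed.

(** The defining representation is transported by h: linearity moves h inside
xi + R gamma + S X, the mixing pair (R, S) and hence H are untouched, and events
on h X are events on X, so independence persists.  Only the normality of h X
depends on the choice of h. *)
Lemma is_GMN_linear d (T : measurableType d) (P : probability T R) m n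
    (h : {mfun 'cV[R]_n >-> 'cV[R]_m}) (Y : {RV P >-> 'cV[R]_n})
    (xi gamma : 'cV[R]_n) (Sigma : 'M[R]_n) (Sigma' : 'M[R]_m)
    (H : probability (R * R)%type R) :
  linear h ->
  (forall d' (T' : measurableType d') (P' : probability T' R)
     (X : {RV P' >-> 'cV[R]_n}),
     is_mvn X 0 Sigma -> is_mvn (h \o X : {RV P' >-> 'cV[R]_m}) 0 Sigma') ->
  is_GMN Y xi Sigma gamma H ->
  is_GMN (h \o Y : {RV P >-> 'cV[R]_m}) (h xi) Sigma' (h gamma) H.
Proof.
move=> hlin hN [d' [T' [P' [X [U [V [r [s [NX indep s0 HE YE]]]]]]]]].
have hD u v : h (u + v) = h u + h v by rewrite -[u]scale1r hlin !scale1r.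
have h0 : h 0 = 0 by apply: (@addIr _ (h 0)); rewrite -hD !add0r.
have hZ a u : h (a *: u) = a *: h u by rewrite -[a *: u]addr0 hlin h0 addr0.
have mh A : measurable A -> measurable (h @^-1` A).
  by move=> mA; rewrite -[X in measurable X]setTI; exact: measurable_funPT.
exists d', T', P', (h \o X : {RV P' >-> 'cV[R]_m}), U, V, r, s.
split => //; first exact: hN.
- by move=> A B C mA mB mC; apply: (indep (h @^-1` A)) => //; exact: mh.
- move=> A mA; rewrite -[LHS]/(distribution P Y (h @^-1` A)) YE; last exact: mh.
  congr (P' _); apply/funext => t /=; congr (A _).
  by rewrite !hD !hZ.
Qed.

End GMN_blocks.

Theorem proposition2 (R : realType) (d1 d2 : nat)
  (hd1 : (0 < d1)%N) (hd2 : (0 < d2)%N)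
  (d : measure_display) (T : measurableType d) (P : probability T R)
  (Y : {RV P >-> 'cV[R]_(d1 + d2)})
  (xi gamma : 'cV[R]_(d1 + d2)) (Sigma : 'M[R]_(d1 + d2))
  (H : probability (R * R)%type R)
  (hY : is_GMN Y xi Sigma gamma H) :
  is_GMN (usubmx \o Y : {RV P >-> 'cV[R]_d1})
    (usubmx xi) (ulsubmx Sigma) (usubmx gamma) H /\
  is_GMN (dsubmx \o Y : {RV P >-> 'cV[R]_d2})
    (dsubmx xi) (drsubmx Sigma) (dsubmx gamma) H.
Proof.
split.
- apply: (@is_GMN_linear R _ _ _ _ _ (@usubmx R d1 d2 1)) hY
    => [a u v|d' T' P' X NX].
    exact: linearP.
  by rewrite -(linear0 (@usubmx R d1 d2 1)); exact: is_mvn_usubmx.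
- apply: (@is_GMN_linear R _ _ _ _ _ (@dsubmx R d1 d2 1)) hY
    => [a u v|d' T' P' X NX].
    exact: linearP.
  by rewrite -(linear0 (@dsubmx R d1 d2 1)); exact: is_mvn_dsubmx.
Qed.
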